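(* Let $\mathcal{SF}$ be the set of square-free positive integers, let $EF$ (respectively $OF$) be the set of positive integers $n$ with $\Omega(n)$ even (respectively odd), and list $EF\cap\mathcal{SF}=(a_n)_{n\ge1}$ and $OF\cap\mathcal{SF}=(b_n)_{n\ge1}$ in increasing order. Then both $(a_n)$ and $(b_n)$ are rotationally distributed in $\mathbb N$ but not uniformly distributed in $\mathbb Z$, and thus neither is uniformly behaved in $\mathbb N$.
   Context: $\Omega(n)$ is the number of prime factors of $n$ counted with multiplicity ($\Omega(1)=0$). A positive integer $n$ is square-free if $p^2\nmid n$ for all primes $p$. Let $(c_n)_{n\ge1}$ be a sequence of natural numbers. A sequence $(x_n)$ of real numbers is uniformly distributed modulo 1 if for all $0\le s<t\le1$, $\lim_{N\to\infty}\frac1N\#\{1\le n\le N: s\le x_n \bmod 1\le t\}=t-s$. The sequence $(c_n)$ is rotationally distributed in $\mathbb N$ if for every irrational $0<\theta<1$ the sequence $(c_n\theta)$ is uniformly distributed modulo 1. $(c_n)$ is uniformly distributed in $\mathbb Z$ if for all $m\in\mathbb N$, $m\ge1$, and $r\in\{0,\dots,m-1\}$, $\lim_{N\to\infty}\frac1N\#\{1\le n\le N: c_n\equiv r \pmod m\}=\frac1m$. $(c_n)$ is uniformly behaved in $\mathbb N$ if for every real $0<\theta<1$, $\lim_{N\to\infty}\frac1N\sum_{n=1}^N e^{2\pi i c_n\theta}=0$. *)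

(* Defs.v *)
From mathcomp Require Import all_boot all_order all_algebra.
From mathcomp Require Import all_classical all_reals all_analysis.
From mathcomp.real_closed Require Import complex.
Set Implicit Arguments.
Unset Strict Implicit.
Unset Printing Implicit Defensive.
Import Order.TTheory GRing.Theory Num.Theory.
Import numFieldNormedType.Exports.
Local Open Scope classical_set_scope.
Local Open Scope ring_scope.

Definition Omega (n : nat) : nat := (\sum_(p <- primes n) logn p n)%N.

Definition SF : set nat :=
  [set n | (0 < n)%N /\ forall p, prime p -> ~~ (p ^ 2 %| n)%N].

Definition EF : set nat := [set n | (0 < n)%N /\ ~~ odd (Omega n)].

Definition OF : set nat := [set n | (0 < n)%N /\ odd (Omega n)].

(** Sequences indexed by n >= 1 are functions on [nat] whose value at 0 is
    irrelevant: every definition below only looks at indices n >= 1. *)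

Definition lists_increasingly (A : set nat) (c : nat -> nat) : Prop :=
  (forall m n, (0 < m)%N -> (m < n)%N -> (c m < c n)%N) /\
  c @` [set n | (0 < n)%N] = A.

Definition mod1 (R : realType) (x : R) : R := x - (Num.floor x)%:~R.

Definition uniformly_distributed_mod1 (R : realType) (x : nat -> R) : Prop :=
  forall s t : R, 0 <= s -> s < t -> t <= 1 ->
    (N%:R^-1 * (count (fun n => s <= mod1 (x n) <= t) (index_iota 1 N.+1))%:R : R)
      @[N --> \oo] --> t - s.

Definition rotationally_distributed (R : realType) (c : nat -> nat) : Prop :=
  forall theta : R, irrational theta -> 0 < theta -> theta < 1 ->
    uniformly_distributed_mod1 (fun n => (c n)%:R * theta).

Definition uniformly_distributed_in_Z (R : realType) (c : nat -> nat) : Prop :=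
  forall m r : nat, (1 <= m)%N -> (r < m)%N ->
    (N%:R^-1 * (count (fun n => c n == r %[mod m]) (index_iota 1 N.+1))%:R : R)
      @[N --> \oo] --> (m%:R^-1 : R).

(** e^(2 pi i x) *)
Definition e2pii (R : realType) (x : R) : R[i] :=
  (cos (2 * pi * x) +i* sin (2 * pi * x))%C.

(** The regular algebra [R[i]^o] is only there to give the field R[i] of
    complex numbers the topology of its norm. *)
Definition uniformly_behaved (R : realType) (c : nat -> nat) : Prop :=
  forall theta : R, 0 < theta -> theta < 1 ->
    (N%:R^-1 * \sum_(1 <= n < N.+1) e2pii ((c n)%:R * theta) : R[i]^o)
      @[N --> \oo] --> (0 : R[i]^o).

(** The sets to be listed are infinite, so [lists_increasingly] is satisfiable
    for them; such a listing is moreover unique. *)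

Lemma lists_increasingly_exists (A : set nat) :
  ~ A 0%N -> (forall m, exists2 n, A n & (m < n)%N) ->
  exists c, lists_increasingly A c.
Proof.
move=> A0 Ainf.
have Aex m : exists n, (m < n)%N && `[< A n >].
  by have [n An mn] := Ainf m; exists n; rewrite mn; apply/asboolP.
pose next m := ex_minn (Aex m).
have nextA m : A (next m).
  by rewrite /next; case: ex_minnP => k /andP[_ /asboolP].
have next_gt m : (m < next m)%N.
  by rewrite /next; case: ex_minnP => k /andP[].
have next_min m n : A n -> (m < n)%N -> (next m <= n)%N.
  move=> An mn; rewrite /next; case: ex_minnP => k _; apply.
  by rewrite mn; apply/asboolP.
exists (fun n => iter n next 0%N); split.
  move=> m n _; elim: n => // n IHn; rewrite ltnS leq_eqVlt => /predU1P[->|mn].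
    exact: next_gt.
  exact: ltn_trans (IHn mn) (next_gt _).
apply/seteqP; split => [_ [[//|n] _ <-]|n An]; first exact: nextA.
have iter_ge k : (k <= iter k next 0)%N.
  by elim: k => // k IHk; apply: leq_ltn_trans IHk (next_gt _).
have ex : exists k, (n <= iter k next 0)%N by exists n; apply: iter_ge.
case: (ex_minnP ex) => -[|k] nk kmin.
  by move: nk An; rewrite leqn0 => /eqP ->.
exists k.+1 => //; apply/eqP; rewrite eqn_leq nk andbT /=.
apply: next_min => //; rewrite ltnNge; apply/negP => /kmin.
by rewrite ltnn.
Qed.

Lemma lists_increasingly_unique (A : set nat) (c d : nat -> nat) :
  lists_increasingly A c -> lists_increasingly A d ->
  forall n, (0 < n)%N -> c n = d n.
Proof.
move=> [cinc cA] [dinc dA].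
suff half (f g : nat -> nat) :
    (forall m n, (0 < m)%N -> (m < n)%N -> (f m < f n)%N) ->
    (forall m n, (0 < m)%N -> (m < n)%N -> (g m < g n)%N) ->
    f @` [set n | (0 < n)%N] = g @` [set n | (0 < n)%N] ->
    forall n, (0 < n)%N -> (f n <= g n)%N.
  move=> n n0; apply/eqP; rewrite eqn_leq.
  by apply/andP; split; apply: half => //; rewrite cA dA.
move=> finc ginc fg; elim=> // n IHn _.
have /= [k k0 fk] : (f @` [set n | (0 < n)%N]) (g n.+1) by rewrite fg; exists n.+1.
rewrite -fk; have [nk|] := leqP n.+1 k.
  by move: nk; rewrite leq_eqVlt => /predU1P[->//|/(finc n.+1 k isT)/ltnW].
rewrite ltnS => kn; have n0 := leq_trans k0 kn.
have := leq_ltn_trans (IHn n0) (ginc _ _ n0 (ltnSn n)).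
rewrite -fk; move: kn; rewrite leq_eqVlt => /predU1P[->|/(finc _ _ k0)].
  by rewrite ltnn.
by move=> /ltnW; rewrite leqNgt => /negPf ->.
Qed.

Lemma OF_SF_prime p : prime p -> (OF `&` SF) p.
Proof.
move=> pp; have p0 := prime_gt0 pp; split; split=> //.
  by rewrite /Omega primes_prime // big_seq1 logn_prime // eqxx.
move=> q pq; rewrite pfactor_dvdn // logn_prime //.
by case: (q == p).
Qed.

Lemma EF_SF_double_prime p : prime p -> (2 < p)%N -> (EF `&` SF) (2 * p)%N.
Proof.
move=> pp p2; have p0 := prime_gt0 pp.
have lg q : prime q -> logn q (2 * p) = ((q == 2) + (q == p))%N.
  by move=> pq; rewrite lognM // !logn_prime.
split; split; rewrite ?muln_gt0 //.
  have perm : perm_eq (primes (2 * p)) [:: 2; p].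
    apply: uniq_perm; rewrite ?primes_uniq //= ?inE ?(ltn_eqF p2) // => q.
    by rewrite primesM // !primes_prime // !inE.
  rewrite /Omega (perm_big _ perm) /= big_cons big_seq1 !lg //.
  by rewrite !eqxx (ltn_eqF p2) (gtn_eqF p2).
move=> q pq; rewrite pfactor_dvdn ?muln_gt0 // lg // -ltnNge.
by case: eqP => [->|_]; rewrite ?(ltn_eqF p2) //; case: (q == p).
Qed.

Lemma EF_SF_listable : exists a, lists_increasingly (EF `&` SF) a.
Proof.
apply: lists_increasingly_exists => [[[//]]|m].
have [p + pp] := prime_above (maxn 2 m); rewrite gtn_max => /andP[p2 mp].
exists (2 * p)%N; first exact: EF_SF_double_prime.
by rewrite (leq_trans mp) // leq_pmull.
Qed.

Lemma OF_SF_listable : exists b, lists_increasingly (OF `&` SF) b.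
Proof.
apply: lists_increasingly_exists => [[[//]]|m].
by have [p mp pp] := prime_above m; exists p => //; apply: OF_SF_prime.
Qed.

(* Main.v *)
Require Import Defs.
From mathcomp Require Import all_boot all_order all_algebra.
From mathcomp Require Import all_classical all_reals all_analysis.
From mathcomp.real_closed Require Import complex.
From mathcomp Require Import ring lra zify.
Set Implicit Arguments.
Unset Strict Implicit.
Unset Printing Implicit Defensive.
Import Order.TTheory GRing.Theory Num.Theory.
Import numFieldNormedType.Exports.
Local Open Scope classical_set_scope.
Local Open Scope ring_scope.

(** Let [F n = cos (2 pi k theta n + b)] with [theta] irrational and [k > 0].
    The indicator function of the square-free numbers whose number of prime
    factors has a given parity is half the sum or half the difference of
    [sqfree] and of the Moebius function, so the exponential sums of [a] and
    [b] are controlled once the sums of [sqfree n * F n] and [mobius n * F n]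
    over [n <= N] are known to be o(N).  Both functions are bounded and
    multiplicative, and for such functions this is the Daboussi-Katai theorem:
    by the criterion [katai] it is enough that [F (p m)] and [F (q m)] are
    asymptotically uncorrelated for distinct primes [p] and [q], and their
    correlation is in fact bounded, since a product of cosines is a sum of two
    cosines whose frequencies [(p - q) k theta] and [(p + q) k theta] are
    irrational ([cos_correlation]).

    The criterion rests on the Turan-Kubilius inequality for a finite set [s]
    of primes: most integers have about [A = \sum_(p <- s) 1 / p] divisors in
    [s], so [A * \sum f F] is close to a sum over the pairs (p, m) with
    [p m <= N], which is bilinear and is estimated by the Cauchy-Schwarz
    inequality.  The gain is a power of [A], which is unbounded because the sum
    of the reciprocals of the primes diverges ([sum_inv_primes_unbounded]).

    To pass from sums over [n <= x] to averages along the listing [c] one needs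
    [c N = O(N)], that is, a positive lower density ([SF_parity_density]).  It
    comes from the pairing of [m] with [2 m] for odd square-free [m]: exactly
    one of the two has the prescribed parity.  Finally Weyl's criterion, proved
    here with Fejer kernels sampled at equidistant nodes
    ([weyl_criterion]), turns the cancellation into uniform distribution
    modulo 1.

    Neither listing is uniformly distributed modulo 4, as no square-free number
    is a multiple of 4.  For the same reason, with [w = 'i ^+ c n] one has
    [w + w ^+ 2 + w ^+ 3 = -1] for all [n], so the exponential averages at
    [theta = 1/4], [1/2] and [3/4] cannot all tend to 0.

    Everything up to that last point uses cosines with an arbitrary phase
    instead of complex exponentials: the phase [b] covers the sine, and the
    family is stable under the operations above. *)

(** * Sums over multiples and sublinear functions *)

Lemma sum_multiples (V : nmodType) (d N : nat) (g : nat -> V) : (0 < d)%N ->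
  \sum_(1 <= n < N.+1 | (d %| n)%N) g n =
  \sum_(1 <= m < (N %/ d).+1) g (d * m)%N.
Proof.
move=> d0; rewrite -big_filter -(big_map (muln d) xpredT g).
apply: perm_big; apply: uniq_perm.
- by rewrite filter_uniq // iota_uniq.
- rewrite map_inj_uniq ?iota_uniq // => x y /eqP.
  by rewrite eqn_pmul2l // => /eqP.
move=> n; rewrite mem_filter mem_index_iota ltnS.
apply/andP/mapP => [[/dvdnP[k ->]]|[m + ->]].
  rewrite muln_gt0 => /andP[/andP[k0 _]] kN; exists k; last by rewrite mulnC.
  by rewrite mem_index_iota k0 ltnS leq_divRL.
rewrite mem_index_iota ltnS leq_divRL // => /andP[m0 mN].
by rewrite dvdn_mulr // muln_gt0 d0 m0 mulnC.
Qed.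

Section Sublinear.
Context {R : realType}.

(** This is [S N = o(N)].  Keeping the additive constant rather than a limit
    lets estimates with unspecified bounded terms be combined linearly, and
    substituted along a sequence [c] with [c N = O(N)]. *)
Definition sublinear (S : nat -> R) : Prop :=
  forall e : R, 0 < e -> exists C : R, forall N, `|S N| <= e * N%:R + C.

Lemma eq_sublinear (S T : nat -> R) : S =1 T -> sublinear S -> sublinear T.
Proof. by move=> /funext ->. Qed.

Lemma sublinearD (S T : nat -> R) :
  sublinear S -> sublinear T -> sublinear (fun N => S N + T N).
Proof.
move=> oS oT e e0.
have e20 : 0 < e / 2 by rewrite divr_gt0.
have [C HC] := oS _ e20; have [D HD] := oT _ e20.
exists (C + D) => N; apply: le_trans (ler_normD _ _) _.
apply: le_trans (lerD (HC N) (HD N)) _; lra.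
Qed.

Lemma sublinearZ (c : R) (S : nat -> R) :
  sublinear S -> sublinear (fun N => c * S N).
Proof.
move=> oS e e0; have c0 : 0 < `|c| + 1 by rewrite ltr_wpDl.
have [C HC] := oS _ (divr_gt0 e0 c0).
exists ((`|c| + 1) * C) => N; rewrite normrM.
have : `|c| * `|S N| <= (`|c| + 1) * `|S N| by rewrite ler_wpM2r // lerDl.
move=> /le_trans; apply.
apply: le_trans (ler_wpM2l (ltW c0) (HC N)) _.
by rewrite mulrDr mulrA (mulrCA _ e) divff ?gt_eqF // mulr1.
Qed.

Lemma sublinear_sum (I : Type) (r : seq I) (S : I -> nat -> R) :
  (forall i, sublinear (S i)) -> sublinear (fun N => \sum_(i <- r) S i N).
Proof.
move=> oS; elim: r => [|i r IH].
  move=> e e0; exists 0 => N; rewrite big_nil normr0 addr0.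
  by rewrite mulr_ge0 // ltW.
apply: eq_sublinear (sublinearD (oS i) IH) => N /=.
by rewrite big_cons.
Qed.

Lemma sublinear_cvg (S : nat -> R) (l : R) :
  sublinear (fun N => S N - l * N%:R) ->
  (N%:R^-1 * S N) @[N --> \oo] --> l.
Proof.
move=> oS; apply/cvgrPdist_le => e e0.
have e20 : 0 < e / 2 by rewrite divr_gt0.
have [C HC] := oS _ e20.
near=> N.
have N0 : 0 < N%:R :> R by rewrite ltr0n; near: N; exists 1%N.
have -> : l - N%:R^-1 * S N = - (S N - l * N%:R) / N%:R.
  by field; rewrite gt_eqF.
rewrite normrM normrN normfV (gtr0_norm N0) ler_pdivrMr //.
apply: le_trans (HC N) _.
suff : C <= e / 2 * N%:R by lra.
rewrite mulrC -ler_pdivrMr //.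
near: N; exact: nbhs_infty_ger.
Unshelve. all: by end_near. Qed.

End Sublinear.

(** * Sums of cosines in arithmetic progression *)

Section Trigonometry.
Context {R : realType}.
Implicit Types (a b x t : R).

Lemma cosD2pin x n : cos (x + 2 * pi * n%:R) = cos x :> R.
Proof.
rewrite -(periodicn (@cosD2pi R) n x); congr cos.
by rewrite -[pi *+ 2 *+ n]mulr_natr -[pi *+ 2]mulr_natr; ring.
Qed.

Lemma cosM x t : 2 * cos x * cos t = cos (x - t) + cos (x + t) :> R.
Proof. by rewrite cosB cosD; ring. Qed.

(** The product formula makes the sum telescope. *)
Lemma sin_sum_cos a b (M : nat) :
  2 * sin (a / 2) * \sum_(0 <= m < M) cos (a * m%:R + b) =
  sin (a * M%:R + b - a / 2) - sin (b - a / 2).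
Proof.
elim: M => [|M IH]; first by rewrite big_geq // !mulr0 add0r subrr.
rewrite big_nat_recr //= mulrDr IH.
rewrite (_ : a * M.+1%:R + b - a / 2 = (a * M%:R + b) + a / 2); last first.
  by rewrite -natr1; field.
by rewrite (sinB (a * _ + b)) (sinD (a * _ + b)); ring.
Qed.

Lemma sum_cos_bounded a b (M : nat) :
  `|sin (a / 2)| * `|\sum_(0 <= m < M) cos (a * m%:R + b)| <= 1.
Proof.
rewrite -normrM -(ler_pM2l (ltr0Sn R 1)) -{1}[2%:R]ger0_norm // -normrM mulrA.
rewrite sin_sum_cos mulr1; apply: le_trans (ler_normB _ _) _.
by apply: le_trans (lerD (sin_max _) (sin_max _)) _.
Qed.

Lemma sinpi_neq0 x : 0 < x -> x < 1 -> sin (pi * x) != 0.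
Proof.
move=> x0 x1; rewrite gt_eqF // sin_gt0_pi // mulr_gt0 ?pi_gt0 //=.
by rewrite gtr_pMr ?pi_gt0.
Qed.

(** Up to sign, [sin (pi * x)] only depends on the fractional part of [x],
    which lies strictly between 0 and 1. *)
Lemma sinpi_irrational_neq0 x : irrational x -> sin (pi * x) != 0.
Proof.
move=> ix.
have sinDpin (n : nat) (y : R) : `|sin (y + pi * n%:R)| = `|sin y|.
  rewrite mulr_natr (alternatingn (@sinDpi R)) normrM normrX normrN1 expr1n.
  by rewrite mul1r.
have sinDpiz (z : int) (y : R) : `|sin (y + pi * z%:~R)| = `|sin y|.
  case: z => n; first exact: sinDpin.
  by rewrite NegzE mulrNz -(sinDpin n.+1) mulrN subrK.
have f1 : mod1 x < 1 by rewrite /mod1 ltrBlDl -intrD1 floorD1_gt.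
have f0 : 0 < mod1 x.
  rewrite lt_neqAle subr_ge0 floor_le andbT eq_sym subr_eq0; apply/eqP => xz.
  by apply: ix; exists (Num.floor x)%:~R => //; rewrite ratr_int.
rewrite -normr_eq0 -(subrK (Num.floor x)%:~R x) mulrDr sinDpiz normr_eq0.
exact: sinpi_neq0.
Qed.

End Trigonometry.

(** * Reciprocals of primes *)

Section PrimeReciprocals.
Context {R : realType}.

(** Euler's product bound, without infinite products: splitting off the
    multiples of [p] shows that the sum [T (p :: s)] over the numbers whose
    prime factors lie in [p :: s] satisfies
    [T (p :: s) <= T s + T (p :: s) / p], and
    [(1 - 1/p)^-1 <= 1 + 2/p <= expR (2/p)]. *)
Lemma smooth_harmonic_le (s : seq nat) (N : nat) : all prime s ->
  \sum_(1 <= n < N.+1 | all (mem s) (primes n)) n%:R^-1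
    <= expR (2 * \sum_(p <- s) p%:R^-1) :> R.
Proof.
elim: s => [_|p s IH /= /andP[pp ps]].
  rewrite big_nil mulr0 expR0 big_nat_cond.
  have le1 n :
      [&& (0 < n)%N, (n < N.+1)%N & all (mem [::]) (primes n)] -> n = 1%N.
    case: n => [|[|n]] // /andP[_ /andP[_ /allP/(_ (pdiv n.+2))]].
    by rewrite mem_primes pdiv_prime // pdiv_dvd => /(_ isT).
  case: N le1 => [|N] le1; first by rewrite big_geq.
  rewrite big_ltn_cond //= big_nat_cond big1 ?addr0 ?invr1 // => n.
  move=> /andP[/andP[n2 nN] /andP[_ sn]].
  have := le1 n; rewrite (ltnW n2) nN sn => /(_ isT) n1.
  by rewrite n1 in n2.
have p2 : 2 <= p%:R :> R by rewrite ler_nat prime_gt1.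
set Tps := (X in X <= _).
have T0 : 0 <= Tps by apply: sumr_ge0 => n _; rewrite invr_ge0.
have TE : Tps <= (\sum_(1 <= n < N.+1 | all (mem s) (primes n)) n%:R^-1)
                   + p%:R^-1 * Tps.
  rewrite {1}/Tps (bigID (dvdn p)) /= addrC; apply: lerD.
    rewrite big_mkcond [leRHS]big_mkcond; apply: ler_sum => n _ /=.
    case: ifPn => [/andP[an pn]|_]; last by case: ifP; rewrite ?invr_ge0.
    rewrite ifT //; apply/allP => q qn; move/allP/(_ q qn): an.
    rewrite !inE => /orP[/eqP qp|//]; move: qn pn; rewrite mem_primes qp.
    by case/and3P => _ _ ->.
  under eq_bigl do rewrite andbC.
  rewrite big_mkcondr /= sum_multiples ?prime_gt0 // /Tps mulr_sumr.
  rewrite [leRHS]big_mkcond [leRHS](@big_cat_nat _ _ _ (N %/ p).+1) //=;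
    last first.
    by rewrite ltnS leq_div.
  rewrite -[leLHS]addr0; apply: lerD; last first.
    by apply: sumr_ge0 => n _; case: ifP => // _; rewrite mulr_ge0 ?invr_ge0.
  rewrite !big_nat; apply: ler_sum => m /andP[m0 _].
  rewrite natrM invfM.
  case: ifPn => [|_]; last by case: ifP => // _; rewrite mulr_ge0 ?invr_ge0.
  move=> /allP ap; rewrite ifT //; apply/allP => q qm; apply: ap.
  by rewrite primesM ?m0 ?(prime_gt0 pp) // qm orbT.
rewrite big_cons mulrDr expRD.
have p0 : 0 < p%:R^-1 :> R by rewrite invr_gt0; lra.
have pV : p%:R^-1 <= 2^-1 :> R by rewrite lef_pV2 // posrE; lra.
have e1 : 1 + 2 * p%:R^-1 <= expR (2 * p%:R^-1) :> R by exact: expR_ge1Dx.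
have : expR (2 * p%:R^-1) * ((1 - p%:R^-1) * Tps)
       <= expR (2 * p%:R^-1) * expR (2 * \sum_(j <- s) j%:R^-1).
  rewrite ler_wpM2l ?expR_ge0 //; apply: le_trans (IH ps).
  by rewrite mulrBl mul1r lerBlDr.
apply: le_trans; rewrite mulrA -[leLHS]mul1r ler_wpM2r //.
apply: le_trans (ler_wpM2r _ e1); [|lra].
have : p%:R^-1 * p%:R^-1 <= p%:R^-1 * 2^-1 :> R by rewrite ler_wpM2l // ltW.
lra.
Qed.

(** Every [n <= N] only has prime factors up to [N], so the harmonic sum up to
    [N] is at most the exponential of twice the sum of [1 / p]. *)
Lemma sum_inv_primes_unbounded (B : R) :
  exists M, B <= \sum_(p <- [seq p <- iota 0 M | prime p]) p%:R^-1.
Proof.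
apply: contrapT => /forallNP nB.
apply: (@dvg_harmonic R); apply: nondecreasing_is_cvgn.
  apply/nondecreasing_seqP => n; rewrite !seriesEnat /= big_nat_recr //=.
  by rewrite lerDl invr_ge0.
exists (expR (2 * B)) => _ [N _ <-].
have pM : all prime [seq p <- iota 0 N.+1 | prime p] by rewrite filter_all.
have /negP := nB N.+1; rewrite -ltNge => /ltW.
rewrite -(ler_pM2l (ltr0Sn R 1)) -ler_expR.
apply: le_trans; apply: le_trans (smooth_harmonic_le N pM).
rewrite seriesEnat /= /harmonic /=.
rewrite big_add1 /= [leRHS]big_mkcond /= big_nat [leRHS]big_nat.
apply: ler_sum => n /andP[_ nN].
rewrite ifT //; apply/allP => q; rewrite mem_primes => /and3P[pq _ qn].
have := dvdn_leq (ltn0Sn n) qn; have := prime_gt0 pq.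
by rewrite inE mem_filter pq mem_iota; lia.
Qed.

Lemma sum_inv_sqr_le1 M :
  \sum_(p <- [seq p <- iota 0 M | prime p]) (p%:R ^- 2) <= 1 :> R.
Proof.
rewrite big_filter; have [M2|M2] := leqP M 2.
  rewrite big_seq_cond big1 // => p.
  by rewrite mem_iota => /andP[pM /prime_gt1 p1]; exfalso; lia.
(* Comparison with the telescoping sum of 1 / (n (n - 1)). *)
suff : \sum_(p <- iota 0 M | prime p) (p%:R ^- 2) <= 1 - M.-1%:R^-1 :> R.
  by move=> /le_trans; apply; rewrite lerBlDr lerDl invr_ge0.
have [k ->] : exists k, M = k.+2 by exists M.-2; lia.
elim: k {M M2} => [|k IH].
  by rewrite /= !big_cons big_nil /= invr1 subrr.
rewrite -addn1 iotaD big_cat [X in _ + X <= _]big_cons big_nil.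
rewrite add0n addn1.
have k1 : (k.+1%:R : R) != 0 by rewrite pnatr_eq0.
have k2 : (k.+2%:R : R) != 0 by rewrite pnatr_eq0.
apply: (@le_trans _ _ (1 - k.+1%:R^-1 + k.+2%:R ^- 2)).
  apply: lerD; first exact: IH.
  by case: ifP => _ /=; rewrite ?addr0 // invr_ge0 exprn_ge0.
rewrite /= -addrA lerD2l.
have -> : - k.+1%:R^-1 = - k.+2%:R^-1 - (k.+1%:R * k.+2%:R)^-1 :> R.
  move: k1 k2; rewrite -[k.+2%:R]natr1; move: (k.+1%:R : R) => x x0 x10.
  by field; rewrite x10.
rewrite -addrA gerDl addrC subr_le0 lef_pV2 ?posrE.
- by rewrite expr2 ler_pM2r // ler_nat.
- by rewrite exprn_gt0.
by rewrite mulr_gt0.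
Qed.

End PrimeReciprocals.

(** * The Daboussi-Katai criterion *)

Section Katai.
Context {R : realType}.
Implicit Types (e : R) (u g f F : nat -> R) (s : seq nat) (N : nat).

Lemma natr_divn_le N d : (0 < d)%N -> (N %/ d)%:R <= N%:R / d%:R :> R.
Proof.
move=> d0; rewrite ler_pdivlMr ?ltr0n // -natrM ler_nat; exact: leq_trunc_div.
Qed.

Lemma natr_divn_ge N d : (0 < d)%N -> N%:R / d%:R - 1 <= (N %/ d)%:R :> R.
Proof.
move=> d0; rewrite lerBlDr natr1 ler_pdivrMr ?ltr0n // -natrM ler_nat ltnW //.
exact: ltn_ceil.
Qed.

Lemma sum_dvdn d N : (0 < d)%N ->
  \sum_(1 <= n < N.+1) (d %| n)%N%:R = (N %/ d)%:R :> R.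
Proof.
move=> d0; transitivity (\sum_(1 <= n < N.+1 | (d %| n)%N) (1 : R)).
  by rewrite [RHS]big_mkcond /=; apply: eq_bigr => n _; case: ifP.
by rewrite sum_multiples // sumr_const_nat subn1.
Qed.

Lemma sum_le_divn p N g : (0 < p)%N ->
  \sum_(1 <= m < (N %/ p).+1) g m =
  \sum_(1 <= m < N.+1) (p * m <= N)%N%:R * g m.
Proof.
move=> p0; rewrite [RHS](@big_cat_nat _ _ _ (N %/ p).+1) //=; last first.
  by rewrite ltnS leq_div.
rewrite [X in _ + X]big_nat [X in _ + X]big1 ?addr0 => [|m /andP[mN _]].
  rewrite !big_nat; apply: eq_bigr => m /andP[_ mN].
  by rewrite mulnC -leq_divRL // -ltnS mN mul1r.
by rewrite mulnC -leq_divRL // leqNgt mN mul0r.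
Qed.

(** The inequality [2 |v| <= e v^2 + 1 / e] plays the role of Cauchy-Schwarz;
    with a free parameter [e] no square roots appear. *)
Lemma sum_norm_le e u N : 0 < e ->
  \sum_(1 <= n < N.+1) `|u n|
    <= 2^-1 * (e * (\sum_(1 <= n < N.+1) u n ^+ 2) + e^-1 * N%:R).
Proof.
move=> e0.
have -> : N%:R = \sum_(1 <= n < N.+1) (1 : R) by rewrite sumr_const_nat subn1.
rewrite 2!mulr_sumr -big_split mulr_sumr /=; apply: ler_sum => n _.
rewrite -real_normK ?num_real //; set v := `|u n|.
have := sqr_ge0 (e * v - 1).
rewrite mulr1 -(pmulr_rge0 _ (_ : 0 < e^-1)) ?invr_gt0 //.
rewrite (_ : e^-1 * _ = e * v ^+ 2 - 2 * v + e^-1); first by lra.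
by field; rewrite gt_eqF.
Qed.

(** Turan-Kubilius for a fixed finite set of primes.  By the expansion of the
    square, the main terms [A ^ 2 * N] cancel, because divisibility by [p] and
    by [q] are independent events up to rounding when [p != q]; only the
    diagonal [p = q], which contributes [A * N], and the rounding errors
    survive. *)
Lemma turan_kubilius s N (A : R) : uniq s -> all prime s ->
  A = \sum_(p <- s) p%:R^-1 ->
  \sum_(1 <= n < N.+1) (\sum_(p <- s) (p %| n)%N%:R - A) ^+ 2
    <= A * (N%:R + 2 * (size s)%:R) :> R.
Proof.
move=> us ps AE.
have A0 : 0 <= A by rewrite AE; apply: sumr_ge0 => p _; rewrite invr_ge0.
pose w n : R := \sum_(p <- s) (p %| n)%N%:R.
have -> : \sum_(1 <= n < N.+1) (w n - A) ^+ 2 =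
    \sum_(1 <= n < N.+1) (w n ^+ 2) - 2 * A * (\sum_(1 <= n < N.+1) w n)
    + A ^+ 2 * N%:R.
  have -> : N%:R = \sum_(1 <= n < N.+1) (1 : R) by rewrite sumr_const_nat subn1.
  rewrite !mulr_sumr -sumrB -big_split /=; apply: eq_bigr => n _; ring.
have w1 : A * N%:R - (size s)%:R <= \sum_(1 <= n < N.+1) w n.
  rewrite exchange_big /= AE mulr_suml -sum1_size natr_sum -sumrB.
  rewrite !big_seq; apply: ler_sum => p sp.
  have p0 : (0 < p)%N by rewrite prime_gt0 // (allP ps).
  by rewrite sum_dvdn // mulrC natr_divn_ge.
have w2 : \sum_(1 <= n < N.+1) (w n ^+ 2) <= A ^+ 2 * N%:R + A * N%:R.
  have -> : \sum_(1 <= n < N.+1) (w n ^+ 2) =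
      \sum_(p <- s) \sum_(q <- s) \sum_(1 <= n < N.+1)
        (p %| n)%N%:R * (q %| n)%N%:R.
    under eq_bigr do rewrite expr2 mulr_suml.
    rewrite exchange_big; apply: eq_bigr => p _ /=.
    by under eq_bigr do rewrite mulr_sumr; rewrite exchange_big.
  have -> : A ^+ 2 * N%:R + A * N%:R = \sum_(p <- s) \sum_(q <- s)
      (p%:R^-1 * q%:R^-1 * N%:R + (q == p)%:R * (p%:R^-1 * N%:R)).
    rewrite expr2 -!mulrA -mulrDr {1}AE mulr_suml; apply: eq_big_seq => p sp.
    rewrite big_split /= -!mulr_suml -mulr_sumr -AE -mulrA mulrDr.
    congr (_ + _); rewrite (bigD1_seq p) //= eqxx big1 ?addr0 ?mul1r //.
    by move=> q /negPf ->.
  rewrite big_seq [leRHS]big_seq; apply: ler_sum => p sp.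
  rewrite big_seq [leRHS]big_seq; apply: ler_sum => q sq.
  have pp := allP ps _ sp; have pq := allP ps _ sq.
  have p0 := prime_gt0 pp; have q0 := prime_gt0 pq.
  have [->|npq] := eqVneq q p.
    under eq_bigr do rewrite -natrM mulnb andbb.
    rewrite sum_dvdn // mul1r -[leLHS]add0r; apply: lerD.
      by rewrite !mulr_ge0 ?invr_ge0.
    by rewrite mulrC natr_divn_le.
  have cpq : coprime p q by rewrite prime_coprime // dvdn_prime2 // eq_sym.
  under eq_bigr do rewrite -natrM mulnb -Gauss_dvd //.
  rewrite sum_dvdn ?muln_gt0 ?p0 // mul0r addr0 -invfM -natrM mulrC.
  by rewrite natr_divn_le // muln_gt0 p0.
have w3 := ler_wpM2l A0 w1.
lra.
Qed.

(** The bilinear estimate: after exchanging the sums, [f m] is factored out and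
    bounded by 1, and the square of the inner sum over [p] expands into the
    correlations of [F] at [p m] and [q m].  Only the diagonal terms grow with
    [N]. *)
Lemma katai_main_term f F s (C : nat -> nat -> R) e N :
  (forall n, `|f n| <= 1) -> (forall n, `|F n| <= 1) ->
  uniq s -> all prime s -> 0 < e ->
  (forall p q, prime p -> prime q -> p != q -> forall M,
     `|\sum_(1 <= m < M.+1) F (p * m)%N * F (q * m)%N| <= C p q) ->
  `|\sum_(p <- s) f p * \sum_(1 <= m < (N %/ p).+1) f m * F (p * m)%N| <=
  2^-1 * (e * ((\sum_(p <- s) p%:R^-1) * N%:R
               + \sum_(p <- s) \sum_(q <- s | q != p) C p q) + e^-1 * N%:R).
Proof.
move=> f1 F1 us ps e0 FC.
pose G m := \sum_(p <- s) f p * ((p * m <= N)%N%:R * F (p * m)%N).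
have -> : \sum_(p <- s) f p * \sum_(1 <= m < (N %/ p).+1) f m * F (p * m)%N =
    \sum_(1 <= m < N.+1) f m * G m.
  under [RHS]eq_bigr do rewrite mulr_sumr.
  rewrite exchange_big; apply: eq_big_seq => p sp /=.
  rewrite sum_le_divn ?prime_gt0 ?(allP ps) // mulr_sumr.
  by apply: eq_bigr => m _; ring.
apply: le_trans (ler_norm_sum _ _ _) _.
apply: (@le_trans _ _ (\sum_(1 <= m < N.+1) `|G m|)).
  by apply: ler_sum => m _; rewrite normrM ler_piMl.
apply: le_trans (sum_norm_le G N e0) _.
rewrite ler_wpM2l ?invr_ge0 // lerD2r ler_wpM2l ?(ltW e0) //.
have -> : \sum_(1 <= m < N.+1) G m ^+ 2 = \sum_(p <- s) \sum_(q <- s)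
    f p * f q * \sum_(1 <= m < (N %/ maxn p q).+1) F (p * m)%N * F (q * m)%N.
  under eq_bigr do rewrite expr2 mulr_suml.
  rewrite exchange_big; apply: eq_big_seq => p sp /=.
  under eq_bigr do rewrite mulr_sumr.
  rewrite exchange_big; apply: eq_big_seq => q sq /=.
  rewrite sum_le_divn; last by rewrite leq_max prime_gt0 // (allP ps).
  rewrite mulr_sumr; apply: eq_bigr => m _.
  by rewrite maxnMl geq_max -mulnb natrM; ring.
rewrite mulr_suml -big_split /= big_seq [leRHS]big_seq; apply: ler_sum => p sp.
have pp := allP ps _ sp; have p0 := prime_gt0 pp.
rewrite (bigD1_seq p) //=; apply: lerD.
  rewrite maxnn mulrC; apply: le_trans (_ : (N %/ p)%:R <= _); last first.
    by rewrite mulrC natr_divn_le.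
  have -> : (N %/ p)%:R = (\sum_(1 <= m < (N %/ p).+1) (1 : R)) * 1.
    by rewrite sumr_const_nat subn1 mulr1.
  have sq01 (x : R) : `|x| <= 1 -> 0 <= x * x <= 1.
    by move=> x1; rewrite -expr2 sqr_ge0 -real_normK ?num_real // expr_le1.
  have /andP[? ?] := sq01 _ (f1 p).
  rewrite ler_pM // ?sumr_ge0 // => [m _|].
    by have /andP[] := sq01 _ (F1 (p * m)%N).
  by apply: ler_sum => m _; have /andP[] := sq01 _ (F1 (p * m)%N).
rewrite big_seq_cond [leRHS]big_seq_cond; apply: ler_sum => q /andP[sq qp].
apply: le_trans (ler_norm _) _; rewrite normrM.
apply: le_trans (FC p q pp (allP ps _ sq) _ (N %/ maxn p q)%N);
  last by rewrite eq_sym.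
by rewrite ler_piMl // normrM -[leRHS]mulr1 ler_pM.
Qed.

(** Weighting [n] by its number of prime factors in [s] costs the
    Turan-Kubilius error, and replacing [f (p m)] by [f p * f m] costs at most
    2 for each [m] divisible by [p], whence the term with [B].  Divided by [A],
    every coefficient of [N] on the right becomes small when [e] is small and
    [A] is large compared with [e ^- 2]. *)
Lemma katai_ineq f F s (C : nat -> nat -> R) e N (A B : R) :
  (forall n, `|f n| <= 1) ->
  (forall p m, prime p -> ~~ (p %| m)%N -> f (p * m)%N = f p * f m) ->
  (forall n, `|F n| <= 1) ->
  uniq s -> all prime s -> 0 < e ->
  (forall p q, prime p -> prime q -> p != q -> forall M,
     `|\sum_(1 <= m < M.+1) F (p * m)%N * F (q * m)%N| <= C p q) ->
  A = \sum_(p <- s) p%:R^-1 -> B = \sum_(p <- s) p%:R ^- 2 ->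
  A * `|\sum_(1 <= n < N.+1) f n * F n| <=
    2^-1 * (e * (A * (N%:R + 2 * (size s)%:R)) + e^-1 * N%:R)
    + 2 * B * N%:R
    + 2^-1 * (e * (A * N%:R + \sum_(p <- s) \sum_(q <- s | q != p) C p q)
              + e^-1 * N%:R).
Proof.
move=> f1 fM F1 us ps e0 FC AE BE.
have A0 : 0 <= A by rewrite AE; apply: sumr_ge0 => p _; rewrite invr_ge0.
pose w n : R := \sum_(p <- s) (p %| n)%N%:R.
pose Sw := \sum_(1 <= n < N.+1) f n * F n * w n.
pose S1 := \sum_(p <- s) f p * \sum_(1 <= m < (N %/ p).+1) f m * F (p * m)%N.
have fF1 n : `|f n * F n| <= 1 by rewrite normrM -[leRHS]mulr1 ler_pM.
have main := katai_main_term N f1 F1 us ps e0 FC; rewrite -AE in main.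
have tk : `|\sum_(1 <= n < N.+1) f n * F n * (w n - A)| <=
    2^-1 * (e * (A * (N%:R + 2 * (size s)%:R)) + e^-1 * N%:R).
  apply: le_trans (ler_norm_sum _ _ _) _.
  apply: (@le_trans _ _ (\sum_(1 <= n < N.+1) `|w n - A|)).
    by apply: ler_sum => n _; rewrite normrM ler_piMl.
  apply: le_trans (sum_norm_le _ N e0) _.
  rewrite ler_wpM2l ?invr_ge0 // lerD2r ler_wpM2l ?(ltW e0) //.
  exact: turan_kubilius.
have mid : `|Sw - S1| <= 2 * B * N%:R.
  have -> : Sw = \sum_(p <- s) \sum_(1 <= m < (N %/ p).+1)
      f (p * m)%N * F (p * m)%N.
    rewrite /Sw; under eq_bigr do rewrite mulr_sumr.
    rewrite exchange_big; apply: eq_big_seq => p sp /=.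
    rewrite -(sum_multiples _ (fun n => f n * F n)) ?prime_gt0 ?(allP ps) //.
    rewrite [RHS]big_mkcond /=; apply: eq_bigr => n _.
    by case: ifP => _; rewrite ?mulr1 ?mulr0.
  rewrite -sumrB; apply: le_trans (ler_norm_sum _ _ _) _.
  rewrite BE mulr_sumr mulr_suml big_seq [leRHS]big_seq; apply: ler_sum => p sp.
  have pp := allP ps _ sp; have p0 := prime_gt0 pp.
  rewrite mulr_sumr -sumrB; apply: le_trans (ler_norm_sum _ _ _) _.
  apply: (@le_trans _ _ (2 * (N %/ p %/ p)%:R)); last first.
    rewrite -mulrA ler_wpM2l // -divnMA mulrC -natrX -mulnn.
    by rewrite natr_divn_le // muln_gt0 p0.
  rewrite -sum_dvdn // mulr_sumr; apply: ler_sum => m _.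
  have [pm|pm] := boolP (p %| m)%N;
    last by rewrite fM // mulrA subrr normr0 mulr0.
  apply: le_trans (ler_normB _ _) _; rewrite mulr1.
  by rewrite lerD // normrM -[leRHS]mulr1 ler_pM // normrM -[leRHS]mulr1 ler_pM.
have -> : A * `|\sum_(1 <= n < N.+1) f n * F n| =
    `|(Sw - S1) - (\sum_(1 <= n < N.+1) f n * F n * (w n - A)) + S1|.
  rewrite -{1}(ger0_norm A0) -normrM; congr `|_|.
  under [in RHS]eq_bigr do rewrite mulrBr.
  by rewrite sumrB -/Sw -mulr_suml; ring.
apply: le_trans (ler_normD _ _) _; apply: lerD => //.
apply: le_trans (ler_normB _ _) _; rewrite addrC; exact: lerD.
Qed.

Lemma katai f F :
  (forall n, `|f n| <= 1) ->
  (forall p m, prime p -> ~~ (p %| m)%N -> f (p * m)%N = f p * f m) ->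
  (forall n, `|F n| <= 1) ->
  (forall p q, prime p -> prime q -> p != q -> exists C, forall M,
     `|\sum_(1 <= m < M.+1) F (p * m)%N * F (q * m)%N| <= C) ->
  sublinear (fun N => \sum_(1 <= n < N.+1) f n * F n).
Proof.
move=> f1 fM F1 FC e e0.
have [C HC] : exists C : nat -> nat -> R, forall p q, prime p -> prime q ->
    p != q -> forall M,
    `|\sum_(1 <= m < M.+1) F (p * m)%N * F (q * m)%N| <= C p q.
  have /choice[C HC] : forall pq : nat * nat, exists c : R,
      prime pq.1 -> prime pq.2 -> pq.1 != pq.2 -> forall M,
      `|\sum_(1 <= m < M.+1) F (pq.1 * m)%N * F (pq.2 * m)%N| <= c.
    move=> [p q] /=.
    have [[pp [pq npq]]|no] := pselect (prime p /\ prime q /\ p != q).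
      by have [c Hc] := FC p q pp pq npq; exists c.
    by exists 0 => pp pq npq; case: no.
  by exists (fun p q => C (p, q)) => p q; exact: (HC (p, q)).
(* With [A >= d ^- 2 + d^-1] and [B <= 1], the coefficient of [N] in
   [katai_ineq], divided by [A], is at most [4 d]. *)
pose d := e / 4.
have d0 : 0 < d by rewrite divr_gt0.
have [M HM] := @sum_inv_primes_unbounded R (d ^- 2 + d^-1).
set s := [seq p <- iota 0 M | prime p] in HM.
have us : uniq s by rewrite filter_uniq // iota_uniq.
have ps : all prime s by rewrite filter_all.
set A := \sum_(p <- s) _ in HM.
have dV0 : 0 < d^-1 by rewrite invr_gt0.
have dV2 : 0 < d ^- 2 by rewrite invr_gt0 exprn_gt0.
have A0 : 0 < A by lra.
have B1 := @sum_inv_sqr_le1 R M.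
set D := \sum_(p <- s) \sum_(q <- s | q != p) C p q.
exists ((d * (A * (size s)%:R) + 2^-1 * (d * D)) / A) => N.
rewrite -/s in B1; set B := \sum_(p <- s) _ in B1.
have := katai_ineq N f1 fM F1 us ps d0 HC (erefl A) (erefl B); rewrite -/D.
set S := `|_|; move=> K.
rewrite -(ler_pM2l A0) mulrDr (mulrCA A _ A^-1) divff ?gt_eqF // mulr1.
apply: le_trans K _.
have N0 : 0 <= N%:R :> R by [].
have BN : B * N%:R <= N%:R by rewrite ler_piMl.
have dA1 : d^-1 <= d * A.
  by rewrite -ler_pdivrMl // -expr2 exprVn; lra.
have dA2 : 1 <= d * A by rewrite -ler_pdivrMl // mulr1; lra.
have dA1N := ler_wpM2r N0 dA1.
have dA2N := ler_wpM2r N0 dA2.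
have -> : e = 4 * d by rewrite /d; field.
lra.
Qed.

End Katai.

(** * Weyl's criterion *)

Section Weyl.
Context {R : realType}.
Implicit Types (t u v y : R) (k l M N : nat).

Lemma sinpi_ge (d z : R) : 0 < d -> d <= z -> z <= 1 - d ->
  0 < sin (pi * d) <= sin (pi * z).
Proof.
move=> d0 dz zd; have p0 := @pi_gt0 R.
have d2 : d <= 2^-1 by lra.
have pd2 : pi * d <= pi * 2^-1 by rewrite ler_pM2l.
have pd0 : 0 < pi * d by rewrite mulr_gt0.
rewrite sin_gt0_pi; last by apply/andP; split=> //; lra.
rewrite -cosBpihalf -[leRHS]cosBpihalf -cos_norm -[leRHS]cos_norm /=.
have pdz : pi * d <= pi * z by rewrite ler_pM2l.
have pz : pi * z <= pi - pi * d by rewrite -{2}[pi]mulr1 -mulrBr ler_pM2l.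
have e : `|pi * z - pi / 2| <= `|pi * d - pi / 2|.
  by rewrite [leRHS]ler0_norm ?ler_norml; [apply/andP; split|]; lra.
have db : `|pi * d - pi / 2| <= pi by rewrite ler0_norm; lra.
move: e; rewrite le_eqVlt => /predU1P[->//|e].
apply/ltW; rewrite ltr_cos // !in_itv /= normr_ge0 //=.
exact: le_trans (ltW e) db.
Qed.

(** The unnormalized Fejer kernel, [M] times the usual one: the squared
    modulus of a geometric sum, as [fejerE] shows. *)
Definition fejer M t : R :=
  \sum_(0 <= k < M) \sum_(0 <= l < M) cos (2 * pi * (k%:R - l%:R) * t).

Lemma fejerE M t : fejer M t =
  (\sum_(0 <= k < M) cos (2 * pi * t * k%:R)) ^+ 2
  + (\sum_(0 <= k < M) sin (2 * pi * t * k%:R)) ^+ 2.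
Proof.
rewrite !expr2 !mulr_suml -big_split /=; apply: eq_bigr => k _.
rewrite !mulr_sumr -big_split /=; apply: eq_bigr => l _.
by rewrite -cosB; congr cos; ring.
Qed.

Lemma fejer_ge0 M t : 0 <= fejer M t.
Proof. by rewrite fejerE addr_ge0 // sqr_ge0. Qed.

(** Both sums in [fejerE] are sums of cosines, with phases 0 and [- pi / 2]. *)
Lemma fejer_le M t : sin (pi * t) ^+ 2 * fejer M t <= 2.
Proof.
rewrite fejerE mulrDr -!exprMn.
have h b :
    (sin (pi * t) * \sum_(0 <= k < M) cos (2 * pi * t * k%:R + b)) ^+ 2 <= 1.
  rewrite -real_normK ?num_real // expr_le1 // normrM.
  have := sum_cos_bounded (2 * pi * t) b M.
  by rewrite (_ : 2 * pi * t / 2 = pi * t) //; field.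
rewrite (_ : 2 = 1 + 1) //; apply: lerD.
  by have := h 0; under eq_bigr do rewrite addr0.
by have := h (- (pi / 2)); under eq_bigr do rewrite cosBpihalf.
Qed.

(** Makes the frequency a natural number smaller than [M] for [k, l < M]. *)
Lemma cos_dist k l v :
  cos (2 * pi * (k%:R - l%:R) * v) =
  cos (2 * pi * (maxn k l - minn k l)%:R * v).
Proof.
have [kl|/ltnW kl] := leqP k l; last by rewrite natrB.
rewrite natrB // -cosN; congr cos; ring.
Qed.

(** Equidistant nodes integrate trigonometric polynomials of degree less than
    [M] exactly, so the off-diagonal terms vanish.  Thus the functions
    [fejer M (t - j / M) / M ^ 2] form a partition of unity, and no integral is
    needed to smooth an indicator function. *)
Lemma sum_fejer M t : (0 < M)%N ->
  \sum_(0 <= j < M) fejer M (t - j%:R / M%:R) = M%:R ^+ 2.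
Proof.
move=> M0; have Mn0 : M%:R != 0 :> R by rewrite pnatr_eq0 -lt0n.
have row k l : (k < M)%N -> (l < M)%N ->
    \sum_(0 <= j < M) cos (2 * pi * (k%:R - l%:R) * (t - j%:R / M%:R))
      = (l == k)%:R * M%:R :> R.
  move=> kM lM; under eq_bigr do rewrite cos_dist.
  have [->|nkl] := eqVneq l k.
    rewrite maxnn minnn subnn; under eq_bigr do rewrite mulr0 mul0r cos0.
    by rewrite sumr_const_nat subn0 mul1r.
  set d := (maxn k l - minn k l)%N.
  have d0 : (0 < d)%N by rewrite /d; lia.
  have dM : (d < M)%N by rewrite /d; lia.
  pose a : R := - (2 * pi * (d%:R / M%:R)).
  have aM : a * M%:R = - (2 * pi * d%:R) by rewrite /a; field.
  have sa0 : 2 * sin (a / 2) != 0 :> R.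
    rewrite mulf_neq0 ?pnatr_eq0 // (_ : a / 2 = - (pi * (d%:R / M%:R)));
      last first.
      by rewrite /a; field.
    rewrite sinN oppr_eq0 sinpi_neq0 // ?divr_gt0 ?ltr0n //.
    by rewrite ltr_pdivrMr ?ltr0n // mul1r ltr_nat.
  rewrite mul0r; apply: (mulfI sa0); rewrite mulr0.
  rewrite (eq_bigr (fun j : nat => cos (a * j%:R + 2 * pi * d%:R * t)));
    last first.
    by move=> j _; congr cos; rewrite /a; field.
  rewrite sin_sum_cos aM -(periodicn (@sinD2pi R) d (_ - a / 2))
    -[pi *+ 2 *+ d]mulr_natr.
  rewrite -[pi *+ 2]mulr_natr; apply/eqP; rewrite subr_eq0; apply/eqP.
  by congr sin; ring.
rewrite /fejer exchange_big /=.
rewrite (eq_big_nat _ _ (F2 := fun=> M%:R)) => [|k /andP[_ kM]].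
  by rewrite sumr_const_nat subn0 -[LHS]mulr_natr.
rewrite exchange_big /= (eq_big_nat _ _ (F2 := fun l => (l == k)%:R * M%:R)).
  rewrite -mulr_suml (bigD1_seq k) ?mem_index_iota ?iota_uniq //= eqxx.
  by rewrite big1 ?addr0 ?mul1r // => l /negPf ->.
by move=> l /andP[_ lM]; rewrite row.
Qed.

(** The nodes [i / M] with [i >= L] stay at distance at least [d] from [y]
    modulo 1, so they carry little of the total mass [M ^ 2]. *)
Lemma fejer_concentrates M L (d y : R) : (0 < M)%N -> (L <= M)%N ->
  0 < d -> d <= y -> y <= L%:R / M%:R - d ->
  M%:R ^+ 2 <= \sum_(0 <= i < L) fejer M (y - i%:R / M%:R)
               + M%:R * (2 / sin (pi * d) ^+ 2).
Proof.
move=> M0 LM d0 dy yL.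
have MR0 : 0 < M%:R :> R by rewrite ltr0n.
rewrite -(sum_fejer y M0) (@big_cat_nat _ _ _ L) //= lerD2l.
apply: (@le_trans _ _ (\sum_(L <= i < M) 2 / sin (pi * d) ^+ 2)); last first.
  rewrite sumr_const_nat -[leLHS]mulr_natl ler_wpM2r ?ler_nat ?leq_subr //.
  by rewrite divr_ge0 // sqr_ge0.
rewrite big_nat [leRHS]big_nat; apply: ler_sum => i /andP[Li iM].
have i1 : i%:R / M%:R <= 1 :> R by rewrite ler_pdivrMr // mul1r ler_nat ltnW.
have iL : L%:R / M%:R <= i%:R / M%:R :> R.
  by rewrite ler_pM2r ?invr_gt0 // ler_nat.
have /andP[sd sz] := @sinpi_ge d (i%:R / M%:R - y) d0 ltac:(lra) ltac:(lra).
rewrite ler_pdivlMr ?exprn_gt0 // mulrC.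
apply: le_trans (fejer_le M (y - i%:R / M%:R)).
rewrite ler_wpM2r ?fejer_ge0 // -(opprB _ y) mulrN sinN sqrrN.
by rewrite lerXn2r // nnegrE ltW // (lt_le_trans sd).
Qed.

(** The arc [[s, t]], widened by [d] on both sides, contains [L] of the
    nodes [s - d + i / M], where [L / M] is about [t - s + 2 d].  The
    trigonometric polynomial [T] of these nodes is nonnegative and nearly at
    least [M ^ 2] on [[s, t]], and its average along the sequence is its
    constant coefficient [L * M]. *)
Lemma weyl_upper (y : nat -> R) (s t e : R) :
  (forall k, (0 < k)%N -> forall b,
     sublinear (fun N => \sum_(1 <= n < N.+1) cos (2 * pi * k%:R * y n + b))) ->
  s <= t -> 0 < e -> exists C, forall N,
  (count (fun n => s <= y n <= t) (index_iota 1 N.+1))%:R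
    <= (t - s + e) * N%:R + C.
Proof.
move=> oy st e0.
pose d := e / 8; have d0 : 0 < d by rewrite divr_gt0.
pose K := 2 / sin (pi * d) ^+ 2.
have K0 : 0 <= K by rewrite divr_ge0 // sqr_ge0.
pose M := (Num.trunc ((K + 1) / d)).+1.
have M0 : (0 < M)%N by [].
have MR0 : 0 < M%:R :> R by rewrite ltr0n.
have MK : K + 1 <= d * M%:R.
  by rewrite mulrC -ler_pdivrMr // ltW // truncnS_gt.
pose w := M%:R * (t - s + 2 * d).
have w0 : 0 <= w by rewrite mulr_ge0 //; lra.
pose L := (Num.trunc w).+1.
have Lw : w < L%:R by exact: truncnS_gt.
have wL : L%:R <= w + 1 by rewrite -natr1 lerD2r truncn_le.
pose T z := \sum_(0 <= i < L) fejer M (z - (s - d) - i%:R / M%:R).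
have T0 z : 0 <= T z by apply: sumr_ge0 => i _; exact: fejer_ge0.
have oT : sublinear
    (fun N => \sum_(1 <= n < N.+1) T (y n) - L%:R * M%:R * N%:R).
  pose S i k l N := \sum_(1 <= n < N.+1)
    cos (2 * pi * (k%:R - l%:R) * (y n - (s - d) - i%:R / M%:R))
    - (l == k)%:R * N%:R.
  have oS i k l : sublinear (S i k l).
    have [lk|nlk] := eqVneq l k.
      apply: (@eq_sublinear _ (fun=> 0)); last first.
        by move=> r r0; exists 0 => N; rewrite normr0 addr0 mulr_ge0 // ltW.
      move=> N; rewrite /S lk eqxx mul1r.
      under eq_bigr do rewrite subrr mulr0 mul0r cos0.
      by rewrite sumr_const_nat subn1 subrr.
    have k0 : (0 < maxn k l - minn k l)%N by lia.
    pose b := - (2 * pi * (maxn k l - minn k l)%:R * (s - d + i%:R / M%:R)).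
    apply: eq_sublinear (oy _ k0 b) => N; rewrite /S (negPf nlk) mul0r subr0.
    by apply: eq_bigr => n _; rewrite cos_dist; congr cos; rewrite /b; ring.
  have := sublinear_sum (index_iota 0 L) (fun i =>
    sublinear_sum (index_iota 0 M) (fun k =>
      sublinear_sum (index_iota 0 M) (oS i k))).
  apply: eq_sublinear => N.
  transitivity (\sum_(0 <= i < L) (\sum_(1 <= n < N.+1)
      fejer M (y n - (s - d) - i%:R / M%:R) - M%:R * N%:R)); last first.
    rewrite sumrB exchange_big sumr_const_nat subn0 -[X in _ - X]mulr_natl.
    by rewrite mulrA.
  apply: eq_bigr => i _; rewrite /S.
  transitivity (\sum_(0 <= k < M) (\sum_(1 <= n < N.+1) \sum_(0 <= l < M)
      cos (2 * pi * (k%:R - l%:R) * (y n - (s - d) - i%:R / M%:R)) - N%:R)).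
    apply: eq_big_nat => k /andP[_ kM]; rewrite sumrB exchange_big /=.
    congr (_ - _); rewrite -mulr_suml.
    rewrite (bigD1_seq k) ?mem_index_iota ?iota_uniq //=.
    by rewrite eqxx big1 ?addr0 ?mul1r // => l /negPf ->.
  rewrite sumrB sumr_const_nat subn0 -[X in _ - X]mulr_natl; congr (_ - _).
  by rewrite exchange_big.
have [C HC] := oT _ (mulr_gt0 d0 (exprn_gt0 2 MR0)).
exists (C / M%:R ^+ 2) => N; set c := (X in X <= _).
have cN : c <= N%:R.
  rewrite ler_nat; apply: leq_trans (count_size _ _) _.
  by rewrite size_iota subn1.
have C0 : 0 <= C.
  by have := HC 0%N; rewrite !mulr0 add0r; exact: le_trans.
(* If the widened arc covers the circle, the trivial bound suffices. *)
have [LM|ML] := leqP L M; last first.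
  have st1 : 1 <= t - s + 2 * d.
    have : M.+1%:R <= w + 1 by apply: le_trans wL; rewrite ler_nat.
    by rewrite -natr1 lerD2r /w -[leLHS]mulr1 ler_pM2l.
  apply: (le_trans cN); rewrite -[leLHS]addr0 lerD //; last first.
    by rewrite divr_ge0 // exprn_ge0.
  rewrite -[leLHS]mul1r ler_wpM2r //; apply: le_trans st1 _.
  by rewrite lerD2l /d; lra.
have wLM : t - s + 2 * d <= L%:R / M%:R by rewrite ler_pdivlMr // mulrC ltW.
have HT : M%:R ^+ 2 * c <= \sum_(1 <= n < N.+1) T (y n) + M%:R * K * N%:R.
  rewrite /c -sumn_count sumnE big_map natr_sum mulr_sumr.
  have -> : N%:R = \sum_(1 <= n < N.+1) (1 : R) by rewrite sumr_const_nat subn1.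
  rewrite mulr_sumr -big_split /=; apply: ler_sum => n _.
  have [/andP[sy yt]|_] := boolP (s <= y n <= t);
    last by rewrite mulr0 addr_ge0 // mulr1 mulr_ge0.
  rewrite !mulr1; apply: fejer_concentrates => //; lra.
have := HC N; rewrite ler_norml => /andP[_ HN].
have N0 : 0 <= N%:R :> R by [].
have M20 : 0 < M%:R ^+ 2 :> R by rewrite exprn_gt0.
rewrite -(ler_pM2l M20) mulrDr (mulrCA _ C) divff ?gt_eqF // mulr1.
apply: le_trans HT _.
have LMN : L%:R * M%:R * N%:R <= (w + 1) * M%:R * N%:R.
  by rewrite !ler_wpM2r // ltW.
have KMN : (K + 1) * M%:R * N%:R <= d * M%:R * M%:R * N%:R.
  by rewrite !ler_wpM2r // ltW.
have eN : M%:R ^+ 2 * (e * N%:R) = 8 * (d * M%:R ^+ 2 * N%:R).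
  by rewrite /d; field.
have dN : 0 <= d * M%:R ^+ 2 * N%:R by rewrite !mulr_ge0 // ltW.
rewrite /w in LMN; lra.
Qed.

Lemma mod1_itv (x : R) : 0 <= mod1 x < 1.
Proof.
rewrite /mod1 subr_ge0 floor_le ltrBlDl /=.
by have := floorD1_gt x; rewrite intrD.
Qed.

Lemma cos_mod1 k (x b : R) :
  cos (2 * pi * k%:R * mod1 x + b) = cos (2 * pi * k%:R * x + b).
Proof.
have cosDz (z : int) v : cos (v + 2 * pi * z%:~R) = cos v :> R.
  case: z => n; first exact: cosD2pin.
  by rewrite NegzE mulrNz -(cosD2pin _ n.+1) mulrN subrK.
rewrite -[RHS](cosDz (- (k%:Z * Num.floor x))) mulrNz intrM -pmulrn.
by congr cos; rewrite /mod1; ring.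
Qed.

(** The upper bound for arcs is enough: applied to [[0, s]] and [[t, 1]], it
    yields the lower bound for [[s, t]]. *)
Lemma weyl_criterion (x : nat -> R) :
  (forall k, (0 < k)%N -> forall b,
     sublinear (fun N => \sum_(1 <= n < N.+1) cos (2 * pi * k%:R * x n + b))) ->
  uniformly_distributed_mod1 x.
Proof.
move=> ox s t s0 st t1; apply: sublinear_cvg.
have oy k : (0 < k)%N -> forall b, sublinear (fun N =>
    \sum_(1 <= n < N.+1) cos (2 * pi * k%:R * mod1 (x n) + b)).
  move=> k0 b; apply: eq_sublinear (ox k k0 b) => N.
  by apply: eq_bigr => n _; rewrite cos_mod1.
move=> e e0; have e20 : 0 < e / 2 by rewrite divr_gt0.
have [C1 H1] := weyl_upper oy (ltW st) e0.
have [C2 H2] := weyl_upper oy s0 e20.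
have [C3 H3] := weyl_upper oy t1 e20.
exists (Num.max C1 (C2 + C3)) => N.
have cover : N%:R <=
    (count (fun n => s <= mod1 (x n) <= t) (index_iota 1 N.+1))%:R
    + (count (fun n => 0 <= mod1 (x n) <= s) (index_iota 1 N.+1))%:R
    + (count (fun n => t <= mod1 (x n) <= 1) (index_iota 1 N.+1))%:R :> R.
  rewrite -!natrD ler_nat -!sumn_count !sumnE !big_map -!big_split /=.
  rewrite -[leqLHS](_ : \sum_(1 <= n < N.+1) 1 = N)%N; last first.
    by rewrite sum_nat_const_nat subn1 muln1.
  apply: leq_sum => n _; have /andP[-> /ltW ->] := mod1_itv (x n).
  have [sx|/ltW ->] := leP s (mod1 (x n)); last by rewrite /= addn1 addSn.
  by have [xt|/ltW ->] := leP (mod1 (x n)) t; rewrite /= ?addn1 ?addSn.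
have := H1 N; have := H2 N; have := H3 N => h3 h2 h1.
have m1 : C1 <= Num.max C1 (C2 + C3) by rewrite le_max lexx.
have m2 : C2 + C3 <= Num.max C1 (C2 + C3) by rewrite le_max lexx orbT.
rewrite ler_norml; apply/andP; split; lra.
Qed.

End Weyl.

(** * Parity classes of square-free numbers *)

Section SquareFree.
Context {R : realType}.
Implicit Types (p m n N : nat) (o : bool).

Lemma SF_Mprime p m : prime p -> ~~ (p %| m)%N -> SF (p * m)%N <-> SF m.
Proof.
move=> pp pm; have p0 := prime_gt0 pp.
have m0 : (0 < m)%N by case: m pm => //; rewrite dvdn0.
split=> -[_ sq].
  by split=> // q pq; apply: contra (sq q pq) => /dvdn_mull; apply.
split=> [|q pq]; first by rewrite muln_gt0 p0.
have [->|qp] := eqVneq q p.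
  by rewrite -mulnn dvdn_pmul2l.
rewrite Gauss_dvdr; first exact: sq.
by rewrite coprimeXl // prime_coprime // dvdn_prime2.
Qed.

Lemma Omega_Mprime p m : prime p -> ~~ (p %| m)%N ->
  Omega (p * m) = (Omega m).+1.
Proof.
move=> pp pm; have p0 := prime_gt0 pp.
have m0 : (0 < m)%N by case: m pm => //; rewrite dvdn0.
have perm : perm_eq (primes (p * m)) (p :: primes m).
  apply: uniq_perm => /=; rewrite ?primes_uniq ?andbT //.
    by rewrite mem_primes pp m0.
  by move=> q; rewrite primesM // primes_prime // !inE.
rewrite /Omega (perm_big _ perm) /= big_cons lognM // logn_prime // eqxx.
rewrite lognE pp m0 (negPf pm) addn0 add1n; congr S.
apply: eq_big_seq => q; rewrite mem_primes => /and3P[pq _ qm].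
rewrite lognM // logn_prime //; have [qp|//] := eqVneq q p.
by rewrite -qp qm in pm.
Qed.

Definition sqfree n : R := `[< SF n >]%:R.

Definition mobius n : R := sqfree n * (-1) ^+ Omega n.

Lemma sqfree_prime p : prime p -> sqfree p = 1.
Proof. by move=> /OF_SF_prime[_ sp]; rewrite /sqfree asboolT. Qed.

Lemma mobius_prime p : prime p -> mobius p = -1.
Proof.
move=> pp; rewrite /mobius sqfree_prime // mul1r -signr_odd.
by have [[_ ->] _] := OF_SF_prime pp; rewrite expr1.
Qed.

Lemma sqfreeM p m : prime p -> ~~ (p %| m)%N ->
  sqfree (p * m)%N = sqfree p * sqfree m.
Proof.
move=> pp pm; rewrite (sqfree_prime pp) mul1r /sqfree.
by rewrite (asbool_equiv_eq (SF_Mprime pp pm)).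
Qed.

Lemma mobiusM p m : prime p -> ~~ (p %| m)%N ->
  mobius (p * m)%N = mobius p * mobius m.
Proof.
move=> pp pm; rewrite (mobius_prime pp) /mobius sqfreeM // (sqfree_prime pp).
by rewrite Omega_Mprime // exprS; ring.
Qed.

Lemma sqfree_le1 n : `|sqfree n| <= 1.
Proof. by rewrite /sqfree; case: asboolP; rewrite ?normr1 ?normr0. Qed.

Lemma mobius_le1 n : `|mobius n| <= 1.
Proof. by rewrite normrM normrX normrN1 expr1n mulr1 sqfree_le1. Qed.

Definition SF_parity o : set nat := [set n | SF n /\ odd (Omega n) = o].

Lemma EF_SF : EF `&` SF = SF_parity false.
Proof.
apply/seteqP; split=> n /=; first by move=> [[_ /negPf]].
by move=> [sn on]; split=> //; split; [case: sn|rewrite on].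
Qed.

Lemma OF_SF : OF `&` SF = SF_parity true.
Proof.
apply/seteqP; split=> n /=; first by move=> [[]].
by move=> [sn on]; split=> //; split; [case: sn|rewrite on].
Qed.

Lemma SF_parityE o n :
  `[< SF_parity o n >]%:R = 2^-1 * (sqfree n + (-1) ^+ o * mobius n).
Proof.
rewrite /mobius -(signr_odd _ (Omega n)) /sqfree asbool_and.
case: asboolP => sn /=; last first.
  by rewrite mul0r !mulr0 addr0 mulr0.
rewrite (asbool_equiv_eq (rwP eqP)) asboolb.
by case: o; case: odd; rewrite /= ?expr1 ?expr0; lra.
Qed.

(** The criterion applies to [sqfree] and to [mobius], hence to their linear
    combination [SF_parityE]; the class itself is not multiplicative. *)
Lemma SF_parity_cos_sublinear o (a b : R) :
  (forall p q, prime p -> prime q -> p != q -> exists C, forall M,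
     `|\sum_(1 <= m < M.+1) cos (a * (p * m)%:R + b) * cos (a * (q * m)%:R + b)|
     <= C) ->
  sublinear (fun N => \sum_(1 <= n < N.+1)
    `[< SF_parity o n >]%:R * cos (a * n%:R + b)).
Proof.
move=> corr; pose F n : R := cos (a * n%:R + b).
have F1 n : `|F n| <= 1 by exact: cos_max.
have oq := katai sqfree_le1 sqfreeM F1 corr.
have om := katai mobius_le1 mobiusM F1 corr.
have := sublinearZ 2^-1 (sublinearD oq (sublinearZ ((-1) ^+ o) om)).
apply: eq_sublinear => N; rewrite mulr_sumr -big_split mulr_sumr.
by apply: eq_bigr => n _; rewrite SF_parityE /= -/(F n); ring.
Qed.

Lemma irrationalMn (x : R) (z : int) :
  z != 0 -> irrational x -> irrational (z%:~R * x).
Proof.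
move=> z0 ix [q _ qx]; apply: ix; exists (q / z%:~R) => //.
rewrite fmorph_div /= ratr_int qx mulrAC divff ?mul1r //.
by rewrite intr_eq0.
Qed.

Lemma sum_cos_irrational (x b : R) : irrational x -> exists C, forall M : nat,
  `|\sum_(1 <= m < M.+1) cos (2 * pi * x * m%:R + b)| <= C.
Proof.
move=> ix; exists (`|sin (pi * x)|^-1) => M.
have sx : 0 < `|sin (pi * x)| by rewrite normr_gt0 sinpi_irrational_neq0.
rewrite -[leRHS]mulr1 ler_pdivlMl //.
have := sum_cos_bounded (2 * pi * x) (2 * pi * x + b) M.
rewrite (_ : 2 * pi * x / 2 = pi * x); last by field.
rewrite big_add1 /=; congr (_ * `|_| <= _); apply: eq_bigr => m _.
by congr cos; rewrite -natr1; ring.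
Qed.

(** The product of the two cosines is half the sum of two cosines whose
    frequencies [k (p - q) theta] and [k (p + q) theta] are irrational. *)
Lemma cos_correlation (theta b : R) (k p q : nat) : irrational theta ->
  (0 < k)%N -> (0 < q)%N -> p != q -> exists C, forall M,
  `|\sum_(1 <= m < M.+1) cos (2 * pi * k%:R * theta * (p * m)%:R + b)
     * cos (2 * pi * k%:R * theta * (q * m)%:R + b)| <= C.
Proof.
move=> it k0 q0 pq.
have [C1 H1] : exists C, forall M : nat, `|\sum_(1 <= m < M.+1)
    cos (2 * pi * ((k%:Z * (p%:Z - q%:Z))%:~R * theta) * m%:R + 0)| <= C.
  apply: sum_cos_irrational; apply: irrationalMn => //.
  by rewrite mulf_neq0 ?subr_eq0 //; lia.
have [C2 H2] : exists C, forall M : nat, `|\sum_(1 <= m < M.+1)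
    cos (2 * pi * ((k * (p + q))%:Z%:~R * theta) * m%:R + 2 * b)| <= C.
  apply: sum_cos_irrational; apply: irrationalMn => //.
  by rewrite eqz_nat -lt0n muln_gt0 k0 addn_gt0 q0 orbT.
exists (2^-1 * (C1 + C2)) => M.
apply: le_trans (ler_wpM2l _ (lerD (H1 M) (H2 M))); last by rewrite invr_ge0.
apply: le_trans (ler_wpM2l _ (ler_normD _ _)); last by rewrite invr_ge0.
rewrite -[2^-1 in leRHS]ger0_norm ?invr_ge0 // -normrM -big_split mulr_sumr /=.
rewrite le_eqVlt; apply/orP; left; apply/eqP; congr `|_|; apply: eq_bigr => m _.
set u := _ * (p * m)%:R + b; set v := _ * (q * m)%:R + b.
have -> : cos u * cos v = 2^-1 * (2 * cos u * cos v) by field.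
rewrite cosM; congr (_ * (cos _ + cos _)); rewrite /u /v.
  by rewrite intrM intrB -!pmulrn !natrM; ring.
by rewrite -pmulrn !natrM natrD; ring.
Qed.

End SquareFree.

(** * Density of the parity classes and their listings *)

Section Density.
Context {R : realType}.
Implicit Types (m n N x y : nat) (o : bool).

(** Since [4 j (j + 1) < (2 j + 1) ^ 2], the sum is dominated by a telescoping
    one. *)
Lemma sum_inv_odd_sqr_le y :
  \sum_(1 <= j < y.+1) ((2 * j + 1) ^ 2)%:R^-1 <= 4^-1 :> R.
Proof.
suff : \sum_(1 <= j < y.+1) ((2 * j + 1) ^ 2)%:R^-1
         <= 4^-1 * (1 - y.+1%:R^-1) :> R.
  move=> /le_trans; apply.
  have : 0 <= y.+1%:R^-1 :> R by rewrite invr_ge0.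
  by move: (y.+1%:R^-1 : R) => v v0; lra.
elim: y => [|y IH]; first by rewrite big_geq // invr1 subrr mulr0.
rewrite big_nat_recr //=; apply: le_trans (lerD IH (lexx _)) _.
set z : R := y.+1%:R; have z0 : 0 < z by rewrite ltr0n.
have -> : y.+2%:R = z + 1 by rewrite /z natr1.
have -> : ((2 * y.+1 + 1) ^ 2)%:R = (2 * z + 1) ^+ 2
  by rewrite natrX natrD natrM.
rewrite -subr_ge0.
have -> : 4^-1 * (1 - (z + 1)^-1) - (4^-1 * (1 - z^-1) + ((2 * z + 1) ^+ 2)^-1)
   = (4 * z * (z + 1) * (2 * z + 1) ^+ 2)^-1.
  field; rewrite !gt_eqF //; lra.
by rewrite invr_ge0 !mulr_ge0 ?sqr_ge0 //; lra.
Qed.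

Lemma sqfree_sieve y m : odd m -> (m <= y)%N ->
  1 - \sum_(1 <= j < y.+1) ((2 * j + 1) ^ 2 %| m)%N%:R <= sqfree m :> R.
Proof.
move=> om my; rewrite /sqfree; case: asboolP => sm.
  by rewrite lerBlDr lerDl; apply: sumr_ge0.
have m0 : (0 < m)%N by case: m om {my sm}.
have [p pp pm] : exists2 p, prime p & (p ^ 2 %| m)%N.
  apply: contrapT => no; apply: sm; split=> // p pp; apply/negP => pm.
  by apply: no; exists p.
have op : odd p.
  by apply: dvdn_odd om; apply: dvdn_trans pm; rewrite dvdn_exp.
have p1 := prime_gt1 pp.
have pE : p = (2 * p./2 + 1)%N by rewrite -[LHS]odd_double_half op; lia.
have py : (p <= y)%N.
  apply: leq_trans my; apply: leq_trans (dvdn_leq m0 pm).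
  by rewrite -mulnn leq_pmull // prime_gt0.
rewrite subr_le0 (bigD1_seq p./2) ?iota_uniq //=; last first.
  by rewrite mem_index_iota; lia.
by rewrite -pE pm lerDl; apply: sumr_ge0.
Qed.

(** Half of the numbers up to [y] are odd, and the odd squares greater than 1
    sieve out at most a quarter of [y]. *)
Lemma odd_sqfree_density y :
  y%:R / 4 <= \sum_(1 <= m < y.+1 | odd m) sqfree m :> R.
Proof.
have sieve : \sum_(1 <= m < y.+1 | odd m)
      (1 - \sum_(1 <= j < y.+1) ((2 * j + 1) ^ 2 %| m)%N%:R)
    <= \sum_(1 <= m < y.+1 | odd m) sqfree m :> R.
  rewrite big_nat_cond [leRHS]big_nat_cond; apply: ler_sum => m.
  by move=> /andP[/andP[_ my] om]; apply: sqfree_sieve.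
apply: le_trans sieve; rewrite sumrB.
have odds : y%:R / 2 <= \sum_(1 <= m < y.+1 | odd m) (1 : R).
  have : \sum_(1 <= m < y.+1) (1 : R) = y%:R by rewrite sumr_const_nat subn1.
  rewrite (bigID odd) /= [X in _ + X](eq_bigl (dvdn 2)); last first.
    by move=> m; rewrite dvdn2.
  rewrite sum_multiples // sumr_const_nat subn1 /=.
  have := @natr_divn_le R y 2 isT; lra.
have squares : \sum_(1 <= m < y.+1 | odd m)
    \sum_(1 <= j < y.+1) ((2 * j + 1) ^ 2 %| m)%N%:R <= y%:R / 4 :> R.
  rewrite exchange_big /=.
  apply: le_trans (ler_wpM2l (ler0n _ y) (sum_inv_odd_sqr_le y)).
  rewrite mulr_sumr; apply: ler_sum => j _.
  have d0 : (0 < (2 * j + 1) ^ 2)%N by rewrite expn_gt0 addn1.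
  apply: le_trans (natr_divn_le y d0); rewrite -sum_dvdn //.
  by rewrite big_mkcond; apply: ler_sum => m _; case: ifP.
lra.
Qed.

(** Multiplication by 2 switches the parity, so for each odd square-free
    [m <= x / 2] exactly one of [m] and [2 m] lies in the class. *)
Lemma SF_parity_density o x :
  (x%:R - 1) / 8 <= \sum_(1 <= n < x.+1) `[< SF_parity o n >]%:R :> R.
Proof.
pose g n : R := `[< SF_parity o n >]%:R; rewrite -/(g _).
have g0 n : 0 <= g n by [].
set y := (x %/ 2)%N.
have half : (x%:R - 1) / 8 <= y%:R / 4 :> R.
  have : (x <= 2 * y + 1)%N by rewrite /y; lia.
  by rewrite -(ler_nat R) natrD natrM; lra.
apply: le_trans half _; apply: le_trans (odd_sqfree_density y) _.
rewrite [leRHS](bigID odd) /= [X in _ <= _ + X](eq_bigl (dvdn 2)); last first.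
  by move=> n; rewrite dvdn2.
rewrite sum_multiples // -/y.
apply: (@le_trans _ _ (\sum_(1 <= m < y.+1 | odd m) g m
                       + \sum_(1 <= m < y.+1 | odd m) g (2 * m)%N)).
  rewrite -big_split /=; apply: ler_sum => m om.
  have m2 : ~~ (2 %| m)%N by rewrite dvdn2 om.
  rewrite /g !SF_parityE (sqfreeM _ m2) // (mobiusM _ m2) //.
  rewrite (@sqfree_prime R 2) // (@mobius_prime R 2) //; lra.
apply: lerD; last first.
  by rewrite big_mkcond; apply: ler_sum => m _; case: ifP.
rewrite [leRHS](@big_cat_nat _ _ _ y.+1) //=; last by rewrite ltnS leq_div.
by rewrite lerDl; apply: sumr_ge0.
Qed.

Lemma sum_listing (A : set nat) (c : nat -> nat) (g : nat -> R) N :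
  lists_increasingly A c -> ~ A 0%N -> (0 < N)%N ->
  \sum_(1 <= n < N.+1) g (c n) =
  \sum_(1 <= k < (c N).+1) `[< A k >]%:R * g k.
Proof.
move=> [cinc cA] A0 N0.
have Ac n : (0 < n)%N -> A (c n) by move=> n0; rewrite -cA; exists n.
transitivity (\sum_(1 <= k < (c N).+1 | `[< A k >]) g k); last first.
  rewrite [LHS]big_mkcond; apply: eq_bigr => k _.
  by case: asboolP; rewrite ?mul1r ?mul0r.
rewrite -[RHS]big_filter -(big_map c xpredT g).
apply: perm_big; apply: uniq_perm.
- rewrite map_inj_in_uniq ?iota_uniq // => m n.
  rewrite !mem_index_iota => /andP[m0 _] /andP[n0 _] cmn.
  by case: (ltngtP m n) => // [/(cinc _ _ m0)|/(cinc _ _ n0)]; rewrite cmn ltnn.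
- by rewrite filter_uniq // iota_uniq.
have cmono m n : (0 < m)%N -> (m <= n)%N -> (c m <= c n)%N.
  by move=> m0; rewrite leq_eqVlt => /predU1P[->//|/(cinc _ _ m0)/ltnW].
move=> k; rewrite mem_filter mem_index_iota ltnS; apply/mapP/andP.
  move=> [n + ->]; rewrite mem_index_iota ltnS => /andP[n0 nN].
  split; first by apply/asboolP/Ac.
  rewrite cmono // andbT lt0n; apply/eqP => c0; apply: A0.
  by rewrite -c0; apply: Ac.
move=> [/asboolP + /andP[k0 kN]]; rewrite -cA => -[n /= n0 ck].
exists n => //; rewrite mem_index_iota n0 ltnS leqNgt; apply/negP => Nn.
by have := cinc _ _ N0 Nn; rewrite ck ltnNge kN.
Qed.

Lemma SF_parity_rotational o (c : nat -> nat) :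
  lists_increasingly (SF_parity o) c -> rotationally_distributed R c.
Proof.
move=> cA theta it _ _; apply: weyl_criterion => k k0 b.
have A0 : ~ SF_parity o 0%N by move=> [[]].
pose a : R := 2 * pi * k%:R * theta.
have oS : sublinear (fun N => \sum_(1 <= n < N.+1)
    `[< SF_parity o n >]%:R * cos (a * n%:R + b)).
  apply: SF_parity_cos_sublinear => p q pp pq npq.
  exact: cos_correlation (prime_gt0 pq) npq.
move=> e e0; have e90 : 0 < e / 9 by rewrite divr_gt0.
have [C HC] := oS _ e90.
exists C => -[|N].
  by have := HC 0%N; rewrite !big_geq // !mulr0.
(* There are exactly [N.+1] elements of the class up to [c N.+1], so the
   density bound gives [(c N.+1 - 1) / 8 <= N.+1]. *)
have cN : (c N.+1)%:R <= 9 * N.+1%:R :> R.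
  have := SF_parity_density o (c N.+1).
  have := sum_listing (fun=> 1) cA A0 (ltn0Sn N).
  under [X in _ = X -> _]eq_bigr do rewrite mulr1.
  move=> <-; rewrite sumr_const_nat subn1 /= ler_pdivrMr //.
  have : 1 <= N.+1%:R :> R by rewrite ler1n.
  lra.
have -> : \sum_(1 <= n < N.+2) cos (2 * pi * k%:R * ((c n)%:R * theta) + b) =
    \sum_(1 <= n < N.+2) cos (a * (c n)%:R + b).
  by apply: eq_bigr => n _; congr cos; rewrite /a; ring.
rewrite (sum_listing (fun n => cos (a * n%:R + b)) cA A0) //.
apply: le_trans (HC _) _; rewrite lerD2r.
apply: le_trans (ler_wpM2l (ltW e90) cN) _; lra.
Qed.

End Density.

(** * The obstruction modulo 4 *)

Section FourthRoots.
Context {R : realType}.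

Lemma SF_parity_not_dvd4 o (c : nat -> nat) n :
  lists_increasingly (SF_parity o) c -> (0 < n)%N -> ~~ (4 %| c n)%N.
Proof.
move=> [_ cA] n0; have : SF_parity o (c n) by rewrite -cA; exists n.
by move=> [[_ /(_ 2 isT)]].
Qed.

Lemma not_dvd4_not_uniform_Z (c : nat -> nat) :
  (forall n, (0 < n)%N -> ~~ (4 %| c n)%N) -> ~ uniformly_distributed_in_Z R c.
Proof.
move=> c4 /(_ 4 0 isT isT).
have -> : (fun N => N%:R^-1 * (count (fun n => c n == 0 %[mod 4])
    (index_iota 1 N.+1))%:R) = (fun=> 0 : R).
  apply/funext => N; rewrite (@eq_in_count _ _ pred0) ?count_pred0 ?mulr0 //.
  move=> n; rewrite mem_index_iota => /andP[n0 _] /=; rewrite mod0n.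
  by apply: negbTE; exact: c4.
move=> /cvg_lim; rewrite lim_cst // => /(_ (@Rhausdorff R)) /eqP.
by rewrite eq_sym invr_eq0 pnatr_eq0.
Qed.

Lemma e2piiD (x y : R) : e2pii (x + y) = e2pii x * e2pii y.
Proof.
rewrite /e2pii mulrDr cosD sinD; apply/eqP; rewrite eq_complex /=.
by rewrite eqxx /= addrC.
Qed.

Lemma e2pii_quarter n : e2pii (n%:R * 4^-1 : R) = 'i%C ^+ n.
Proof.
elim: n => [|n IH]; first by rewrite mul0r /e2pii mulr0 cos0 sin0.
rewrite -natr1 mulrDl e2piiD IH mul1r exprSr; congr (_ * _).
rewrite /e2pii (_ : 2 * pi * 4^-1 = pi / 2); last by field.
by rewrite cos_pihalf sin_pihalf.
Qed.

(** ['i ^+ n] is a fourth root of unity other than 1, hence a root of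
    [1 + w + w ^ 2 + w ^ 3]. *)
Lemma sum_powers_i n : ~~ (4 %| n)%N ->
  'i%C ^+ n + 'i%C ^+ n ^+ 2 + 'i%C ^+ n ^+ 3 = -1 :> R[i].
Proof.
move=> n4; set w := 'i%C ^+ n.
have i4 : 'i%C ^+ 4 = 1 :> R[i] by rewrite (exprM _ 2 2) sqr_i sqrrN expr1n.
have w4 : w ^+ 4 = 1 by rewrite -exprM mulnC exprM i4 expr1n.
have w1 : w - 1 != 0.
  rewrite subr_eq0 /w (divn_eq n 4) exprD mulnC exprM i4 expr1n mul1r.
  have : (n %% 4 < 4)%N by rewrite ltn_mod.
  move: n4; rewrite /dvdn; case: (n %% 4)%N => [|[|[|[|//]]]] // _ _.
  - by rewrite expr1 eq_complex /= oner_eq0 andbF.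
  - by rewrite sqr_i eq_sym -subr_eq0 opprK -mulr2n pnatr_eq0.
  by rewrite exprS sqr_i mulrN1 eq_complex /= oppr_eq0 oner_eq0 andbF.
apply: (mulfI w1); apply/eqP; rewrite -subr_eq0.
rewrite (_ : _ - _ = w ^+ 4 - 1); first by rewrite w4 subrr.
by ring.
Qed.

(** The averages at [theta = 1/4], [1/2] and [3/4] add up to -1 for every
    [N > 0], so they do not all tend to 0. *)
Lemma not_dvd4_not_uniformly_behaved (c : nat -> nat) :
  (forall n, (0 < n)%N -> ~~ (4 %| c n)%N) -> ~ uniformly_behaved R c.
Proof.
move=> c4 ub.
pose S j N : R[i]^o :=
  N%:R^-1 * \sum_(1 <= n < N.+1) e2pii ((c n)%:R * (j%:R / 4)).
have cvgS j : (0 < j < 4)%N -> S j N @[N --> \oo] --> (0 : R[i]^o).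
  move=> /andP[j0 j4]; apply: ub; first by rewrite divr_gt0 // ltr0n.
  by rewrite ltr_pdivrMr // mul1r (ltr_nat _ j 4).
have cvg3 : (S 1%N N + S 2%N N + S 3%N N) @[N --> \oo] --> (0 + 0 + 0 : R[i]^o).
  by apply: cvgD; [apply: cvgD|]; exact: cvgS.
have eq1 : \forall N \near \oo, S 1%N N + S 2%N N + S 3%N N = -1.
  exists 1%N => // N /= N0.
  rewrite /S -!mulrDr -!big_split /=.
  rewrite (eq_big_nat _ _ (F2 := fun=> -1)) => [|n /andP[n0 _]].
    rewrite sumr_const_nat subn1 mulNrn mulrN mulVf //.
    by rewrite pnatr_eq0 -lt0n.
  rewrite -(sum_powers_i (c4 n n0)) -!exprM -!e2pii_quarter.
  by congr (e2pii _ + e2pii _ + e2pii _); rewrite ?natrM; field.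
have cvgN1 : (fun=> -1 : R[i]^o) N @[N --> \oo] --> (-1 : R[i]^o) by exact:
  cvg_cst.
have cvg0 : (fun=> -1 : R[i]^o) N @[N --> \oo] --> (0 + 0 + 0 : R[i]^o).
  apply: cvg_trans cvg3; apply: near_eq_cvg.
  exact: eq1.
have : (-1 : R[i]^o) = 0 + 0 + 0 by apply: cvg_unique cvgN1 cvg0.
by move=> /eqP; rewrite !addr0 oppr_eq0 oner_eq0.
Qed.

End FourthRoots.

(** * Distribution of the two listings *)

Theorem theorem10 (R : realType) (a b : nat -> nat)
    (ha : lists_increasingly (EF `&` SF) a)
    (hb : lists_increasingly (OF `&` SF) b) :
  (rotationally_distributed R a /\ ~ uniformly_distributed_in_Z R a
     /\ ~ uniformly_behaved R a) /\
  (rotationally_distributed R b /\ ~ uniformly_distributed_in_Z R b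
     /\ ~ uniformly_behaved R b).
Proof.
have main o (c : nat -> nat) : lists_increasingly (SF_parity o) c ->
    rotationally_distributed R c /\ ~ uniformly_distributed_in_Z R c
    /\ ~ uniformly_behaved R c.
  move=> cA; have c4 n : (0 < n)%N -> ~~ (4 %| c n)%N.
    exact: SF_parity_not_dvd4 cA.
  split; first exact: SF_parity_rotational cA.
  split; first exact: not_dvd4_not_uniform_Z.
  exact: not_dvd4_not_uniformly_behaved.
rewrite EF_SF in ha; rewrite OF_SF in hb.
by split; [exact: main ha|exact: main hb].
Qed.
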